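(* Let $(E,\alpha)$ be a matroid (with $\alpha\neq\emptyset$ its set of bases), and let $e\in E$. Then $\delta^e_\bullet(\alpha)=\alpha\setminus e$ (the deletion of $e$) and $\chi^e_\bullet(\alpha)=\alpha/e$ (the contraction of $e$).
   Context: $2^E$ is the set of subsets of $E$; $X-e=X\setminus\{e\}$ for $e \in X$, $Y+e=Y\cup\{e\}$ for $e \notin Y$. A relation $\lambda\subseteq 2^A\times2^B$ is written $X\mapsto_\lambda Y$ for $(X,Y)\in\lambda$. A collection $\alpha\subseteq 2^E$ is identified with the relation on $2^\emptyset\times 2^E$ given by $\emptyset\mapsto_\alpha Y$ iff $Y\in\alpha$. $\delta^e$ and $\chi^e$ are the relations on $2^E\times 2^{E-e}$ given by: $X\mapsto_{\delta^e}Y$ iff $X=Y\subseteq E-e$; $X\mapsto_{\chi^e}Y$ iff $Y\subseteq E-e$ and $X=Y+e$. Lax composition: for non-empty relations $\lambda\subseteq 2^A\times 2^B$, $\mu\subseteq 2^B\times 2^C$ and $m\ge0$, $X\mapsto_{\lambda\bullet_m\mu}Z$ iff there exist $Y,Y'\subseteq B$ with $X\mapsto_\lambda Y'$, $Y\mapsto_\mu Z$, $|Y\triangle Y'|=m$; $\lambda\bullet\mu:=\lambda\bullet_{m_0}\mu$ with $m_0$ the smallest $m$ for which $\lambda\bullet_m\mu$ is non-empty. For a relation $\lambda$, $\lambda_\bullet(\mu):=\mu\bullet\lambda$; so $\delta^e_\bullet(\alpha)=\alpha\bullet\delta^e$ and $\chi^e_\bullet(\alpha)=\alpha\bullet\chi^e$,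 viewed as collections of subsets of $E-e$. Deletion and contraction: $e$ is a loop of $\alpha$ if no basis contains $e$, and a coloop if every basis contains $e$. Let $\alpha\setminus\!\setminus e=\{X\subseteq E-e: X\in\alpha\}$ and $\alpha/\!/e=\{X\subseteq E-e: X+e\in\alpha\}$. Then $\alpha\setminus e$ is $\alpha\setminus\!\setminus e$ if $e$ is not a coloop and $\alpha/\!/e$ if $e$ is a coloop; $\alpha/e$ is $\alpha/\!/e$ if $e$ is not a loop and $\alpha\setminus\!\setminus e$ if $e$ is a loop. *)

(* Defs.v *)
From mathcomp Require Import all_boot.

Set Implicit Arguments.
Unset Strict Implicit.
Unset Printing Implicit Defensive.

(* Finite ground sets are subsets [A], [B], [E], ... of an arbitrary finite
   type [T], so that [E - e] is simply [E :\ e].  A relation on [2^A x 2^B] is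
   a set of pairs of subsets of [T] contained in [2^A x 2^B]. *)

Definition relation_on (T : finType) (A B : {set T})
    (lam : {set {set T} * {set T}}) : bool :=
  lam \subset setX (powerset A) (powerset B).

Definition symdiff (T : finType) (X Y : {set T}) : {set T} :=
  (X :\: Y) :|: (Y :\: X).

Definition matroid (T : finType) (E : {set T}) (alpha : {set {set T}}) : Prop :=
  [/\ alpha \subset powerset E,
      alpha != set0
    & forall X Y x, X \in alpha -> Y \in alpha -> x \in X :\: Y ->
        exists2 y, y \in Y :\: X & y |: (X :\ x) \in alpha].

(* The identification of a collection with a relation on [2^set0 x 2^E]. *)
Definition rel_of_coll (T : finType) (alpha : {set {set T}}) :
    {set {set T} * {set T}} :=
  [set p : {set T} * {set T} | (p.1 == set0) && (p.2 \in alpha)].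

Definition delta_rel (T : finType) (E : {set T}) (e : T) :
    {set {set T} * {set T}} :=
  [set p : {set T} * {set T} | (p.1 == p.2) && (p.2 \subset E :\ e)].

Definition chi_rel (T : finType) (E : {set T}) (e : T) :
    {set {set T} * {set T}} :=
  [set p : {set T} * {set T} | (p.2 \subset E :\ e) && (p.1 == e |: p.2)].

(* In [lax_comp_at B m lam mu], [B] is the middle ground set. *)
Definition lax_comp_at (T : finType) (B : {set T}) (m : nat)
    (lam mu : {set {set T} * {set T}}) : {set {set T} * {set T}} :=
  [set p : {set T} * {set T} | [exists Y : {set T}, exists Y' : {set T},
     [&& Y \subset B, Y' \subset B, (p.1, Y') \in lam, (Y, p.2) \in mu
       & #|symdiff Y Y'| == m]]].

(* The smallest [m] with [lax_comp_at B m lam mu] non-empty.  Only [m <= #|B|]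
   need be searched, as two subsets of [B] differ in at most [#|B|] elements.
   If there is no such [m] (which happens only when [lam] or [mu] is empty) the
   value is [#|B|.+1] and [lax_comp] is then empty. *)
Definition lax_order (T : finType) (B : {set T})
    (lam mu : {set {set T} * {set T}}) : nat :=
  find (fun m => lax_comp_at B m lam mu != set0) (iota 0 #|B|.+1).

Definition lax_comp (T : finType) (B : {set T})
    (lam mu : {set {set T} * {set T}}) : {set {set T} * {set T}} :=
  lax_comp_at B (lax_order B lam mu) lam mu.

Definition lax_push (T : finType) (B : {set T})
    (lam mu : {set {set T} * {set T}}) : {set {set T} * {set T}} :=
  lax_comp B mu lam.

Definition loop (T : finType) (alpha : {set {set T}}) (e : T) : bool :=
  [forall X in alpha, e \notin X].

Definition coloop (T : finType) (alpha : {set {set T}}) (e : T) : bool :=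
  [forall X in alpha, e \in X].

Definition naive_deletion (T : finType) (E : {set T}) (alpha : {set {set T}})
    (e : T) : {set {set T}} :=
  [set X : {set T} | (X \subset E :\ e) && (X \in alpha)].

Definition naive_contraction (T : finType) (E : {set T})
    (alpha : {set {set T}}) (e : T) : {set {set T}} :=
  [set X : {set T} | (X \subset E :\ e) && (e |: X \in alpha)].

Definition deletion (T : finType) (E : {set T}) (alpha : {set {set T}})
    (e : T) : {set {set T}} :=
  if coloop alpha e then naive_contraction E alpha e
  else naive_deletion E alpha e.

Definition contraction (T : finType) (E : {set T}) (alpha : {set {set T}})
    (e : T) : {set {set T}} :=
  if loop alpha e then naive_deletion E alpha e
  else naive_contraction E alpha e.

Lemma delta_relP (T : finType) (E : {set T}) (e : T) :
  relation_on E (E :\ e) (delta_rel E e).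
Proof.
apply/subsetP=> -[X Y]; rewrite !inE /= => /andP[/eqP-> sYE].
by rewrite sYE (subset_trans sYE) // subsetDl.
Qed.

Lemma chi_relP (T : finType) (E : {set T}) (e : T) :
  e \in E -> relation_on E (E :\ e) (chi_rel E e).
Proof.
move=> eE; apply/subsetP=> -[X Y]; rewrite !inE /= => /andP[sYE /eqP->].
by rewrite sYE subUset sub1set eE (subset_trans sYE) // subsetDl.
Qed.

Lemma rel_of_collP (T : finType) (E : {set T}) (alpha : {set {set T}}) :
  alpha \subset powerset E -> relation_on set0 E (rel_of_coll alpha).
Proof.
move=> /subsetP sa; apply/subsetP=> -[X Y]; rewrite !inE /=.
by move=> /andP[/eqP-> /sa]; rewrite inE sub0set.
Qed.

Lemma lax_comp_neq0 (T : finType) (A B C : {set T})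
    (lam mu : {set {set T} * {set T}}) :
  relation_on A B lam -> relation_on B C mu -> lam != set0 -> mu != set0 ->
  lax_comp B lam mu != set0.
Proof.
move=> /subsetP sl /subsetP sm /set0Pn[[X Y'] lXY] /set0Pn[[Y Z] mYZ].
have := sl _ lXY; have := sm _ mYZ; rewrite !inE /=.
move=> /andP[sYB _] /andP[_ sY'B].
pose P m := lax_comp_at B m lam mu != set0.
have hP : has P (iota 0 #|B|.+1).
  apply/hasP; exists #|symdiff Y Y'|.
    rewrite mem_iota add0n /= ltnS subset_leq_card //.
    by rewrite subUset !(subset_trans (subsetDl _ _)).
  apply/set0Pn; exists (X, Z); rewrite inE.
  by apply/existsP; exists Y; apply/existsP; exists Y'; apply/and5P; split.
have := nth_find 0 hP; rewrite nth_iota //.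
by move: hP; rewrite has_find size_iota.
Qed.

Lemma lax_order_min (T : finType) (B : {set T})
    (lam mu : {set {set T} * {set T}}) (m : nat) :
  m < lax_order B lam mu -> lax_comp_at B m lam mu = set0.
Proof.
move=> lt_m; have := before_find 0 lt_m.
rewrite nth_iota; first by move/negbT; rewrite negbK => /eqP.
by apply: leq_trans lt_m _; rewrite -[leqRHS](size_iota 0) find_size.
Qed.

(* Main.v *)
Require Import Defs.
From mathcomp Require Import all_boot.

(** [delta] relates [Z] to the subset [Z] of [E - e] and [chi] relates [e |: Z]
    to it, so each push-forward selects the [Z] whose partner is at minimal
    distance from a basis.  The distance [0] is attained unless [e] is a coloop
    (for [delta]) or a loop (for [chi]); in these cases every basis differs from
    every partner at [e], so the minimum is [1] and is attained exactly when
    they differ at [e] only. *)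

Lemma symdiffC (T : finType) (X Y : {set T}) : symdiff X Y = symdiff Y X.
Proof. exact: setUC. Qed.

Lemma card_symdiff_eq0 (T : finType) (X Y : {set T}) :
  (#|symdiff X Y| == 0) = (X == Y).
Proof. by rewrite cards_eq0 setU_eq0 !setD_eq0 eqEsubset. Qed.

(** The element [e] itself lies in the symmetric difference, and removing it from [Y] takes out
    nothing else. This turns distance 1 into distance 0 when [e] is a loop or coloop. *)
Lemma card_symdiffD1 (T : finType) (X Y : {set T}) (e : T) :
  e \notin X -> e \in Y -> #|symdiff X Y| = #|symdiff X (Y :\ e)|.+1.
Proof.
move=> eX eY; rewrite (cardsD1 e) !inE eX eY /= add1n; congr (#|pred_of_set _|.+1).
apply/setP=> x; rewrite !inE.
by have [->|] := eqVneq x e; rewrite /= ?(negPf eX).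
Qed.

(** Lets the minimal distance be certified by a guess [m]; the bound [m <= #|B|] places the guess in
    the range searched by [lax_order]. *)
Lemma lax_comp_eq (T : finType) (B : {set T}) (m : nat)
    (lam mu : {set {set T} * {set T}}) :
  m <= #|B| -> lax_comp_at B m lam mu != set0 ->
  (forall k, k < m -> lax_comp_at B k lam mu = set0) ->
  lax_comp B lam mu = lax_comp_at B m lam mu.
Proof.
move=> le_mB m_neq0 lt_m_eq0; congr lax_comp_at.
have hasP : has (fun k => lax_comp_at B k lam mu != set0) (iota 0 #|B|.+1).
  by apply/hasP; exists m; rewrite // mem_iota.
have := nth_find 0 hasP.
rewrite nth_iota; last by move: hasP; rewrite has_find size_iota.
rewrite add0n -/(lax_order B lam mu) => order_neq0.
(* A strict inequality either way would empty a composition known to be non-empty. *)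
case: (ltngtP (lax_order B lam mu) m) => // [/lt_m_eq0|/lax_order_min] eq0.
  by rewrite eq0 eqxx in order_neq0.
by rewrite eq0 eqxx in m_neq0.
Qed.

(** The middle set on the [delta_rel] side is forced to be [Z], so only the choice of a basis
    remains. *)
Lemma mem_lax_comp_delta (T : finType) (E : {set T}) (alpha : {set {set T}})
    (e : T) (m : nat) (X Z : {set T}) :
  alpha \subset powerset E ->
  ((X, Z) \in lax_comp_at E m (rel_of_coll alpha) (delta_rel E e)) =
  [&& X == set0, Z \subset E :\ e
    & [exists Y in alpha, #|symdiff Z Y| == m]].
Proof.
move=> /subsetP alphaE; rewrite inE; apply/existsP/and3P.
  move=> [W /existsP[Y]]; rewrite !inE /=.
  case/and5P=> _ _ /andP[X0 Ya] /andP[/eqP-> sZ] dm; split=> //.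
  by apply/existsP; exists Y; rewrite Ya.
case=> X0 sZ /existsP[Y /andP[Ya dm]]; exists Z; apply/existsP; exists Y.
have := alphaE _ Ya; rewrite !inE /= X0 Ya sZ dm eqxx => ->.
by rewrite (subset_trans sZ) // subsetDl.
Qed.

Lemma mem_lax_comp_chi (T : finType) (E : {set T}) (alpha : {set {set T}})
    (e : T) (m : nat) (X Z : {set T}) :
  alpha \subset powerset E -> e \in E ->
  ((X, Z) \in lax_comp_at E m (rel_of_coll alpha) (chi_rel E e)) =
  [&& X == set0, Z \subset E :\ e
    & [exists Y in alpha, #|symdiff (e |: Z) Y| == m]].
Proof.
move=> /subsetP alphaE eE; rewrite inE; apply/existsP/and3P.
  move=> [W /existsP[Y]]; rewrite !inE /=.
  case/and5P=> _ _ /andP[X0 Ya] /andP[sZ /eqP->] dm; split=> //.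
  by apply/existsP; exists Y; rewrite Ya.
case=> X0 sZ /existsP[Y /andP[Ya dm]]; exists (e |: Z); apply/existsP; exists Y.
have := alphaE _ Ya; rewrite !inE /= X0 Ya sZ dm eqxx => ->.
by rewrite subUset sub1set eE (subset_trans sZ) // subsetDl.
Qed.

Lemma notin_subsetD1 (T : finType) (E Z : {set T}) (e : T) :
  Z \subset E :\ e -> e \notin Z.
Proof. by rewrite subsetD1 => /andP[]. Qed.

Lemma exists_symdiff_eq0 (T : finType) (alpha : {set {set T}}) (Z : {set T}) :
  [exists Y in alpha, #|symdiff Z Y| == 0] = (Z \in alpha).
Proof.
apply/existsP/idP => [[Y /andP[Ya]]|Za].
  by rewrite card_symdiff_eq0 => /eqP->.
by exists Z; rewrite Za card_symdiff_eq0 eqxx.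
Qed.

(** Every basis differs from [Z] at [e], which uses up the whole distance 1, so the two agree
    elsewhere. *)
Lemma exists_symdiff_coloop (T : finType) (alpha : {set {set T}}) (e : T)
    (Z : {set T}) :
  coloop alpha e -> e \notin Z ->
  [exists Y in alpha, #|symdiff Z Y| == 1] = (e |: Z \in alpha).
Proof.
move=> /forall_inP co eZ; apply/existsP/idP => [[Y /andP[Ya]]|Za].
  rewrite (card_symdiffD1 _ _ _ e eZ (co _ Ya)) eqSS card_symdiff_eq0.
  by move=> /eqP->; rewrite setD1K // co.
exists (e |: Z).
by rewrite Za (card_symdiffD1 _ _ _ e) ?setU11 // setU1K // eqSS card_symdiff_eq0 /=.
Qed.

Lemma exists_symdiff_loop (T : finType) (alpha : {set {set T}}) (e : T)
    (Z : {set T}) :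
  loop alpha e -> e \notin Z ->
  [exists Y in alpha, #|symdiff (e |: Z) Y| == 1] = (Z \in alpha).
Proof.
move=> /forall_inP lo eZ.
(* For each basis [Y], passing from [Z] to [e |: Z] raises the distance by exactly one, since [Y]
   avoids [e]. *)
rewrite -[RHS]exists_symdiff_eq0; apply: eq_existsb => Y.
case Ya: (Y \in alpha) => //=.
by rewrite symdiffC (card_symdiffD1 _ _ _ e) ?lo ?setU11 // setU1K // symdiffC.
Qed.

Lemma lax_push_delta (T : finType) (E : {set T}) (alpha : {set {set T}})
    (e : T) :
  alpha \subset powerset E -> alpha != set0 -> e \in E ->
  lax_push E (delta_rel E e) (rel_of_coll alpha)
    = rel_of_coll (deletion E alpha e).
Proof.
move=> alphaE /set0Pn[Y Ya] eE; have YE : Y \subset E.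
  by have := subsetP alphaE _ Ya; rewrite inE.
rewrite /lax_push /deletion; case: ifPn => co.
  have eY := forall_inP co _ Ya.
  rewrite (@lax_comp_eq _ _ 1).
  - apply/setP=> -[X Z]; rewrite mem_lax_comp_delta // !inE /=; congr (_ && _).
    case sZ: (Z \subset _) => //=.
    by rewrite (exists_symdiff_coloop _ _ e) // (notin_subsetD1 _ _ _ _ sZ).
  - by rewrite card_gt0; apply/set0Pn; exists e.
  (* Distance 1 is attained by any basis with [e] removed. *)
  - apply/set0Pn; exists (set0, Y :\ e).
    rewrite mem_lax_comp_delta // eqxx setSD //=.
    by rewrite (exists_symdiff_coloop _ _ e) ?setD11 ?setD1K.
  (* Distance 0 would make [Z], which avoids [e], a basis. *)
  - case=> // _; apply/setP=> -[X Z].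
    rewrite mem_lax_comp_delta // exists_symdiff_eq0 in_set0.
    apply/and3P=> -[_ /notin_subsetD1/negP eZ /(forall_inP co)]; exact: eZ.
(* A basis avoiding [e] is its own partner, so distance 0 is attained and minimality is vacuous. *)
have [W Wa eW] : exists2 W, W \in alpha & e \notin W.
  by move: co; rewrite negb_forall_in => /exists_inP[W]; exists W.
rewrite (@lax_comp_eq _ _ 0) //.
  by apply/setP=> -[X Z]; rewrite mem_lax_comp_delta // exists_symdiff_eq0 !inE.
apply/set0Pn; exists (set0, W).
rewrite mem_lax_comp_delta // exists_symdiff_eq0 eqxx Wa subsetD1 eW !andbT /=.
by have := subsetP alphaE _ Wa; rewrite inE.
Qed.

Lemma lax_push_chi (T : finType) (E : {set T}) (alpha : {set {set T}})
    (e : T) :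
  alpha \subset powerset E -> alpha != set0 -> e \in E ->
  lax_push E (chi_rel E e) (rel_of_coll alpha)
    = rel_of_coll (contraction E alpha e).
Proof.
move=> alphaE /set0Pn[Y Ya] eE; have YE : Y \subset E.
  by have := subsetP alphaE _ Ya; rewrite inE.
rewrite /lax_push /contraction; case: ifPn => lo.
  have eY := forall_inP lo _ Ya.
  rewrite (@lax_comp_eq _ _ 1).
  - apply/setP=> -[X Z]; rewrite mem_lax_comp_chi // !inE /=; congr (_ && _).
    case sZ: (Z \subset _) => //=.
    by rewrite exists_symdiff_loop // (notin_subsetD1 _ _ _ _ sZ).
  - by rewrite card_gt0; apply/set0Pn; exists e.
  (* The basis [Y] avoids [e], and its partner [e |: Y] is at distance 1 from it. *)
  - apply/set0Pn; exists (set0, Y).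
    by rewrite mem_lax_comp_chi // eqxx subsetD1 YE eY exists_symdiff_loop.
  - case=> // _; apply/setP=> -[X Z].
    rewrite mem_lax_comp_chi // exists_symdiff_eq0 in_set0.
    by apply/and3P=> -[_ _ /(forall_inP lo)]; rewrite setU11.
have [W Wa eW] : exists2 W, W \in alpha & e \in W.
  by move: lo; rewrite negb_forall_in => /exists_inP[W Wa /negPn]; exists W.
rewrite (@lax_comp_eq _ _ 0) //.
  by apply/setP=> -[X Z]; rewrite mem_lax_comp_chi // exists_symdiff_eq0 !inE.
(* The partner of [W :\ e] is the basis [W] itself, because [W] contains [e]. *)
apply/set0Pn; exists (set0, W :\ e).
rewrite mem_lax_comp_chi // exists_symdiff_eq0 eqxx setD1K // Wa andbT /=.
by apply: setSD; have := subsetP alphaE _ Wa; rewrite inE.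
Qed.

Theorem proposition6p12 (T : finType) (E : {set T}) (alpha : {set {set T}})
    (e : T) (alphaM : matroid E alpha) (eE : e \in E) :
  lax_push E (delta_rel E e) (rel_of_coll alpha)
    = rel_of_coll (deletion E alpha e) /\
  lax_push E (chi_rel E e) (rel_of_coll alpha)
    = rel_of_coll (contraction E alpha e).
Proof.
case: alphaM => alphaE alpha0 _.
by split; [exact: lax_push_delta | exact: lax_push_chi].
Qed.
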